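(* Consider a nonlinear deterministic system $x_{t+1}=f(x_t)$ given by a continuous map $f:X\to X$ on a compact metric space $(X,d)$, with random initial state $x_0$, estimated via a discrete memoryless channel (DMC). For $\varepsilon>0$ consider the asymptotic estimation objectives $$\text{(E2)}\quad P\Bigl(\limsup_{t\to\infty}d(x_t,\hat x_t)\le\varepsilon\Bigr)=1,\qquad\qquad \text{(E3)}\quad \limsup_{t\to\infty}E\bigl[d(x_t,\hat x_t)^2\bigr]\le\varepsilon .$$ For each of the objectives (E2) and (E3), let $C_0$ be the smallest channel capacity above which the objective can be achieved for every $\varepsilon>0$. Then, for both objectives, $$C_0\ \le\ h_{\mathrm{top}}(f).$$
   Context: All logarithms are to base 2; $\mathbb{Z}_+=\{0,1,2,\dots\}$; $z_{[0,t]}=(z_0,\dots,z_t)$. $h_{\mathrm{top}}(f)\in[0,\infty]$ is the usual topological entropy of $f$ (log base 2). Coding and estimation: a discrete memoryless channel has finite input alphabet $\mathcal{M}=\{1,\dots,M\}$, finite output alphabet $\mathcal{M}'$ and maps the input $q_t$ to an output $q'_t$ with $P(q'_t|q_t,q_{[0,t-1]},q'_{[0,t-1]})=P(q'_t|q_t)$ (a fixed transition probability, with the channel noise independent of $x_0$); its capacity $C$ is the usual Shannon capacity in bits per channel use. One channel use is made per time step. A coding policy is a sequence of maps with $q_t=\gamma^e_t(x_{[0,t]},q'_{[0,t-1]})\in\mathcal{M}$; an estimation policy is a sequence of maps with $\hat x_t=\gamma^d_t(q'_{[0,t]})\in X$. $C_0$ is the infimum of all $C_*\in[0,\infty]$ such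 that over every DMC with capacity $C>C_*$ and for every $\varepsilon>0$ there exist coding and estimation policies achieving the objective with that $\varepsilon$. *)

(* Defs.v *)
From HB Require Import structures.
From mathcomp Require Import all_boot all_order all_algebra finmap.
From mathcomp Require Import all_classical all_reals all_analysis.

Set Implicit Arguments.
Unset Strict Implicit.
Unset Printing Implicit Defensive.

Import Order.TTheory GRing.Theory Num.Theory.
Import numFieldNormedType.Exports.

Local Open Scope classical_set_scope.
Local Open Scope ring_scope.

(* A measurable type must be pointed in order to carry a measure, which the
   metric spaces of the library need not be.  Since X carries the random
   variable x_0, it is nonempty anyway. *)
#[short(type="pmetricType")]
HB.structure Definition PointedMetric (K : numDomainType) :=
  { M of Metric K M & isPointed M }.

Notation borel X := (g_sigma_algebraType (@open X)).

Section entropy.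
Context {R : realType} {X : pmetricType R}.
Variable f : X -> X.

Definition is_spanning (n : nat) (e : R) (F : set X) :=
  forall x, exists2 y, F y &
    forall i, (i < n)%N -> mdist (iter i f x) (iter i f y) <= e.

(* Minimal cardinality of a finite (n, e)-spanning set (+oo if there is none) *)
Definition span_number (n : nat) (e : R) : \bar R :=
  ereal_inf [set (#|` F|%fset%:R)%:E | F in
    [set F : {fset X} | is_spanning n e [set` F]]].

(* Bowen's definition, in base 2.  The value at n = 0 is irrelevant. *)
Definition span_entropy (e : R) : \bar R :=
  limn_esup (fun n => ((n%:R * ln 2)^-1)%:E * lne (span_number n e))%E.

Definition top_entropy : \bar R := lim (span_entropy e @[e --> 0^'+]).

End entropy.

Section channel.
Context {R : realType}.

Record distribution_on (A : finType) := DistributionOn {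
  pmass :> A -> R ;
  pmass_ge0 : forall a, 0 <= pmass a ;
  pmass_sum1 : \sum_a pmass a = 1 }.

Record dmc (A B : finType) := DMC {
  trans :> A -> B -> R ;
  trans_ge0 : forall a b, 0 <= trans a b ;
  trans_sum1 : forall a, \sum_b trans a b = 1 }.

Definition log2 (x : R) : R := ln x / ln 2.

(* Mutual information, in bits, of a joint mass function r on A * B.  Terms with
   r a b = 0 vanish, which is the convention 0 log 0 = 0; in the other terms
   both marginals are positive. *)
Definition mutual_info (A B : finType) (r : A -> B -> R) : R :=
  \sum_a \sum_b
    r a b * log2 (r a b / ((\sum_b' r a b') * (\sum_a' r a' b))).

Definition capacity (A B : finType) (W : dmc A B) : \bar R :=
  ereal_sup [set (mutual_info (fun a b => p a * W a b))%:E
            | p in [set: distribution_on A]].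

End channel.
Arguments distribution_on : clear implicits.
Arguments dmc : clear implicits.

Section estimation.
Context {R : realType} {X : pmetricType R}.
Variable f : X -> X.
Variables (A B : finType).

(* The encoder sees x_0, ..., x_t and the past channel outputs
   q'_0, ..., q'_(t-1).  Measurability makes the channel inputs random
   variables; without it the closed loop below need not exist. *)
Record coding_policy := CodingPolicy {
  encode :> forall t : nat, t.+1.-tuple (borel X) -> t.-tuple B -> A ;
  measurable_encode : forall t (v : t.-tuple B) (a : A),
    measurable [set u : t.+1.-tuple (borel X) | encode u v = a] }.

(* No measurability condition is needed here, because B is finite. *)
Definition estimation_policy := forall t : nat, t.+1.-tuple B -> X.

Section trajectories.
Context {Omega : Type}.
Variables (enc : coding_policy) (dec : estimation_policy).
Variables (x0 : Omega -> X) (y : nat -> Omega -> B).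

Definition state (t : nat) (w : Omega) : X := iter t f (x0 w).

Definition outputs (t : nat) (w : Omega) : t.-tuple B := [tuple y i w | i < t].

Definition channel_input (t : nat) (w : Omega) : A :=
  enc t [tuple (state i w : borel X) | i < t.+1] (outputs t w).

Definition estimate (t : nat) (w : Omega) : X := dec (outputs t.+1 w).

End trajectories.

(* (x0, y) is a run of the closed loop: x0 has law mu, and the output y t of the
   channel W at time t satisfies
     P(y t = b | x0, y 0, ..., y (t-1)) = W (q t) b,
   where q t is the channel input.  The past inputs q 0, ..., q (t-1) are
   functions of the conditioning variables, and conditioning on x0 as well
   expresses that the channel noise is independent of x0.  Outputs being
   discrete, this is written without conditional probabilities. *)
Record closed_loop (mu : probability (borel X) R) (W : dmc R A B)
    (enc : coding_policy) {d : measure_display} {Omega : measurableType d}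
    (P : probability Omega R)
    (x0 : {RV P >-> borel X}) (y : nat -> Omega -> B) : Prop := ClosedLoop {
  initial_law : forall E : set (borel X), measurable E ->
    P (x0 @^-1` E) = mu E ;
  measurable_output : forall t b, measurable [set w | y t w = b] ;
  memoryless : forall (t : nat) (E : set (borel X)) (v : t.-tuple B)
      (a : A) (b : B), measurable E ->
    let past := [set w | [/\ E (x0 w), outputs y t w = v &
                             channel_input enc x0 y t w = a]] in
    P (past `&` [set w | y t w = b]) = ((W a b)%:E * P past)%E }.

End estimation.
Arguments coding_policy {R} X A B.
Arguments estimation_policy {R} X B.

(* An objective is a property, depending on e, of the random processes x_t and
   xhat_t. *)
Definition objective (R : realType) (X : pmetricType R) :=
  forall (d : measure_display) (Omega : measurableType d)
    (P : probability Omega R) (x xhat : nat -> Omega -> X) (e : R), Prop.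

Definition objective_E2 (R : realType) (X : pmetricType R) : objective X :=
  fun d Omega P x xhat e =>
    P [set w | (limn_esup (fun t => (mdist (x t w) (xhat t w))%:E)
                <= e%:E)%E] = 1%E.

Definition objective_E3 (R : realType) (X : pmetricType R) : objective X :=
  fun d Omega P x xhat e =>
    (limn_esup (fun t => 'E_P[(fun w => mdist (x t w) (xhat t w) ^+ 2)%R])
     <= e%:E)%E.

Section threshold.
Context {R : realType} {X : pmetricType R}.
Variables (f : X -> X) (mu : probability (borel X) R) (obj : objective X).

(* The law of (x0, y) is determined by mu, W and the coding policy, so the
   choice of the probability space is immaterial. *)
Definition achieves (A B : finType) (W : dmc R A B) (enc : coding_policy X A B)
    (dec : estimation_policy X B) (e : R) : Prop :=
  forall (d : measure_display) (Omega : measurableType d)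
    (P : probability Omega R) (x0 : {RV P >-> borel X})
    (y : nat -> Omega -> B),
    closed_loop f mu W enc x0 y ->
    obj P (state f x0) (estimate dec y) e.

Definition smallest_capacity : \bar R :=
  ereal_inf [set C : \bar R | (0 <= C)%E /\
    forall (A B : finType) (W : dmc R A B), (C < capacity W)%E ->
    forall e : R, 0 < e ->
    exists (enc : coding_policy X A B) (dec : estimation_policy X B),
      achieves W enc dec e].

End threshold.

(* Main.v *)
Require Import Defs.
From mathcomp Require Import all_boot all_order all_algebra finmap ring lra.
From mathcomp Require Import all_classical all_reals all_analysis.
From mathcomp Require Import measurable_realfun.

(** If a channel has capacity above [top_entropy f], both objectives are met by
    one separated scheme, so the entropy itself is a threshold in the sense of
    [smallest_capacity].

    Time is cut into consecutive blocks of lengths n, n + 1, n + 2, and so on.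
    The encoder knows the whole orbit from [x_0], so during a block it can
    already describe the segment of orbit that the next block covers: it sends
    the index of a point of a spanning set that shadows this segment within
    [e].  For every rate c above the entropy, a segment of length n + 1 needs at
    most 2 ^ (c (n + 1)) indices ([small_spanning_sets]), and as consecutive
    lengths have ratio tending to 1, the channel can carry them in a block of
    length n, for large n, as soon as c is below the capacity.  During the next block the
    estimator follows the orbit of the decoded point ([tracking_close]).

    The maximal error probability over a block decays geometrically with its
    length ([channel_coding]).  It has to be the maximal one, because the law of
    the index is inherited from [mu] and need not be uniform; this is why the
    code comes from the greedy construction of Feinstein ([feinstein]), which
    controls every message, and the Chernoff bound ([chernoff_bound]) for the
    information density.  The closed loop then behaves on each block as the
    product channel driven by the codeword, whatever happened before
    ([block_law], [decoding_error]).

    Block failures are summable, so by Borel-Cantelli almost surely only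
    finitely many blocks fail, which is (E2) ([reliable_E2]).  Their
    probability tends to 0 and the metric of a compact space is bounded, so the
    mean square error is eventually at most [e ^+ 2] up to a vanishing term,
    which is (E3) ([reliable_E3]). *)

Set Implicit Arguments.
Unset Strict Implicit.
Unset Printing Implicit Defensive.

Import Order.TTheory GRing.Theory Num.Theory.
Import numFieldNormedType.Exports.

Local Open Scope classical_set_scope.
Local Open Scope ring_scope.

(** * Maximal codes over a finite channel *)

Section one_shot.
Context {R : realType} (A B : finType).
Variables (p : distribution_on R A) (W : dmc R A B).

Definition output_mass (b : B) : R := \sum_a p a * W a b.

Lemma exists_le_average (F : A -> R) (eps : R) :
  \sum_a p a * F a <= eps -> exists a, F a <= eps.
Proof.
move=> le_eps; apply: contrapT => /forallNP gt_eps.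
have : \sum_a p a * (F a - eps) <= 0.
  under eq_bigr do rewrite mulrBr.
  by rewrite sumrB -mulr_suml pmass_sum1 mul1r subr_le0.
apply/negP; rewrite -ltNge lt_neqAle eq_sym.
have ge0 a : 0 <= p a * (F a - eps).
  rewrite mulr_ge0 ?pmass_ge0// subr_ge0 ltW// ltNge.
  by apply/negP; exact: gt_eps.
rewrite sumr_ge0 ?andbT//; apply/negP => /eqP /psumr_eq0P H.
have := pmass_sum1 p; rewrite big1; first by move/eqP; rewrite eq_sym oner_eq0.
move=> a _; have /eqP := H (fun i _ => ge0 i) a isT.
rewrite mulf_eq0 subr_eq0 => /orP[/eqP//|/eqP Fa].
by case: (gt_eps a); rewrite Fa.
Qed.

(** The joint probability that the likelihood ratio [W a b / output_mass b] is at
    most [g], written without division. *)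
Definition low_density_mass (g : R) : R :=
  \sum_a \sum_(b | W a b <= g * output_mass b) p a * W a b.

(** Feinstein's greedy construction.  The set of outputs on which [dec] is less
    than [n] has been claimed by the first [n] codewords; values at least [n]
    mean unclaimed.  A codeword [a] only claims outputs [b] with
    [W a b > g * output_mass b], so it uses up at most [g^-1] of the output
    mass.  While few codewords have been chosen, most of the mass is unclaimed,
    and a word of at most average error over what is left is good enough. *)
Lemma greedy_code (g eps : R) (M : nat) : 0 < g ->
  M%:R / g + low_density_mass g <= eps ->
  forall n, (n <= M)%N -> exists (c : nat -> A) (dec : B -> nat),
    (forall i, (i < n)%N -> \sum_(b | dec b != i) W (c i) b <= eps) /\
    \sum_(b | (dec b < n)%N) output_mass b <= n%:R / g.
Proof.
move=> g0 hM; elim=> [_|n IHn ltnM].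
  have [a0 _] : exists a : A, (0 : R) <= 0.
    by apply: exists_le_average; rewrite big1// => a _; rewrite mulr0.
  exists (fun=> a0), (fun=> 0%N); split => //.
  by rewrite big_pred0// mul0r.
have [c [dec [errc massc]]] := IHn (ltnW ltnM).
pose bad a b := (dec b < n)%N || (W a b <= g * output_mass b).
have [a ha] : exists a, \sum_(b | bad a b) W a b <= eps.
  apply: exists_le_average.
  apply: le_trans hM.
  apply: (@le_trans _ _ (\sum_(b | (dec b < n)%N) output_mass b
                         + low_density_mass g)); last first.
    rewrite lerD2r (le_trans massc)// ler_pM2r ?invr_gt0//.
    by rewrite ler_nat ltnW.
  rewrite /output_mass exchange_big /low_density_mass -big_split/=.
  apply: ler_sum => a _; rewrite mulr_sumr [leRHS]addrC.
  rewrite (big_mkcond (bad a)) (big_mkcond (fun b => (_ <= _)))/=.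
  rewrite (big_mkcond (fun b => (_ < _)%N)) -big_split/=; apply: ler_sum => b _.
  rewrite /bad; have pW0 : 0 <= p a * W a b by rewrite mulr_ge0 ?pmass_ge0 ?trans_ge0.
  by case: ifP; case: ifP; case: ifP => //=; rewrite ?addr0 ?add0r ?lerDl.
exists (fun i => if (i == n)%N then a else c i).
exists (fun b => if (dec b < n)%N then dec b else
                 if W a b <= g * output_mass b then n.+1 else n); split.
  move=> i; rewrite ltnS leq_eqVlt => /orP[/eqP ->|ltin].
    rewrite eqxx; apply: le_trans ha.
    rewrite (eq_bigl (bad a))// => b; rewrite /bad.
    case: ltnP => [ltn|_]/=; first by rewrite ltn_eqF.
    by case: ifP => _; rewrite ?eqxx// gtn_eqF.
  rewrite (ltn_eqF ltin) (le_trans _ (errc _ ltin))//.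
  rewrite [leLHS](eq_bigl (fun b => dec b != i))// => b.
  case: ltnP => // ledec; rewrite (gtn_eqF (leq_trans ltin ledec)).
  by case: ifP => _; rewrite gtn_eqF// (leq_trans ltin).
rewrite -natr1 mulrDl mul1r.
apply: (@le_trans _ _ (\sum_(b | (dec b < n)%N) output_mass b
         + \sum_b W a b / g)); last first.
  by rewrite lerD// -mulr_suml trans_sum1 mul1r.
rewrite (big_mkcond (fun b => (_ < _.+1)%N)) (big_mkcond (fun b => (_ < n)%N)).
rewrite -big_split/=; apply: ler_sum => b _.
have Wg0 : 0 <= W a b / g by rewrite divr_ge0 ?trans_ge0// ltW.
case: (ltnP (dec b) n) => hdec.
  by rewrite ltnS (ltnW hdec) lerDl.
have [_|gtW] := leP (W a b) (g * output_mass b); first by rewrite ltnn add0r.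
by rewrite ltnSn add0r ler_pdivlMr// mulrC ltW.
Qed.

(** The bound is on the error of every message, not on an average; [t0] only
    serves as the value of the decoder on unclaimed outputs. *)
Lemma feinstein (g eps : R) (T : finType) (t0 : T) : 0 < g ->
  #|T|%:R / g + low_density_mass g <= eps ->
  exists (word : T -> A) (dec : B -> T),
    forall t, \sum_(b | dec b != t) W (word t) b <= eps.
Proof.
move=> g0 hT; have [c [dec [err _]]] := greedy_code g0 hT (leqnn _).
exists (fun t => c (enum_rank t)), (fun b => nth t0 (enum T) (dec b)) => t.
apply: le_trans (err (enum_rank t) (ltn_ord _)).
rewrite [leLHS]big_mkcond [leRHS]big_mkcond/=; apply: ler_sum => b _.
case: ifPn => [neq|_]; last by case: ifP => // _; exact: trans_ge0.
rewrite ifT//; apply: contraNneq neq => ->.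
by rewrite -[t in _ == t]enum_rankK /enum_val; apply/eqP/set_nth_default; rewrite -cardE.
Qed.

End one_shot.

(** * Exponential error bounds for the product channel *)

Section product_channel.
Context {R : realType} (A B : finType) (n : nat).

Lemma sum_prod_ffun (I : finType) (F : 'I_n -> I -> R) :
  \sum_(v : {ffun 'I_n -> I}) \prod_i F i (v i) = \prod_i \sum_a F i a.
Proof. by rewrite bigA_distr_bigA. Qed.

Program Definition product_distribution (p : distribution_on R A) :
    distribution_on R {ffun 'I_n -> A} :=
  @DistributionOn R {ffun 'I_n -> A} (fun u => \prod_i p (u i)) _ _.
Next Obligation. by move=> p u; apply: prodr_ge0 => i _; exact: pmass_ge0. Qed.
Next Obligation.
move=> p; rewrite (sum_prod_ffun (fun=> p)) big1// => i _; exact: pmass_sum1.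
Qed.

Program Definition product_channel (W : dmc R A B) :
    dmc R {ffun 'I_n -> A} {ffun 'I_n -> B} :=
  @DMC R {ffun 'I_n -> A} {ffun 'I_n -> B} (fun u v => \prod_i W (u i) (v i)) _ _.
Next Obligation. by move=> W u v; apply: prodr_ge0 => i _; exact: trans_ge0. Qed.
Next Obligation.
move=> W u; rewrite (sum_prod_ffun (fun i => W (u i))) big1// => i _; exact: trans_sum1.
Qed.

Lemma output_mass_product p W v :
  output_mass (product_distribution p) (product_channel W) v =
  \prod_i output_mass p W (v i).
Proof.
rewrite /output_mass -sum_prod_ffun; apply: eq_bigr => u _.
by rewrite /= -big_split.
Qed.

End product_channel.

Section chernoff.
Context {R : realType} (A B : finType).
Variables (p : distribution_on R A) (W : dmc R A B).
Let q := output_mass p W.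

(** Natural logarithm, to match [expR] in the Chernoff bound; the factor [ln 2]
    of the change of base is accounted for in [mutual_info_density]. *)
Definition info_density (a : A) (b : B) : R := ln (W a b / q b).

Lemma joint_gt0 a b : p a * W a b != 0 -> 0 < W a b /\ 0 < q b.
Proof.
move=> pW0; have pW : 0 < p a * W a b.
  by rewrite lt_neqAle eq_sym pW0 mulr_ge0 ?pmass_ge0 ?trans_ge0.
have Wgt0 : 0 < W a b.
  rewrite lt_neqAle eq_sym trans_ge0 andbT.
  by apply: contraNneq pW0 => ->; rewrite mulr0.
split=> //; apply: lt_le_trans pW _; rewrite /q /output_mass (bigD1 a)//= lerDl.
by apply: sumr_ge0 => i _; rewrite mulr_ge0 ?pmass_ge0 ?trans_ge0.
Qed.

Lemma sum_joint : \sum_a \sum_b p a * W a b = 1.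
Proof.
rewrite -(pmass_sum1 p); apply: eq_bigr => a _.
by rewrite -mulr_sumr trans_sum1 mulr1.
Qed.

Lemma mutual_info_density :
  \sum_a \sum_b p a * W a b * info_density a b =
  mutual_info (fun a b => p a * W a b) * ln 2.
Proof.
have ln2 : ln (2 : R) != 0 by rewrite gt_eqF// ln_gt0// ltr1n.
rewrite /mutual_info mulr_suml; apply: eq_bigr => a _.
rewrite mulr_suml; apply: eq_bigr => b _.
have [->|pW0] := eqVneq (p a * W a b) 0; first by rewrite !mul0r.
rewrite -[RHS]mulrA /log2 divfK//; congr (_ * ln _).
rewrite -mulr_sumr trans_sum1 mulr1 -/(output_mass p W b) -/(q b).
have p0 : p a != 0 by apply: contraNneq pW0 => ->; rewrite mul0r.
have [_ /gt_eqF/negbT q0] := joint_gt0 pW0.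
by field; apply/andP.
Qed.

(** The moment generating function of [c - info_density] at [s]. *)
Definition chernoff_factor (c s : R) : R :=
  \sum_a \sum_b p a * W a b * expR (s * (c - info_density a b)).

(** From [1 - x <= expR (- x)], since [(1 - x) (1 + x + 2 x^2) >= 1] for
    [x <= 1 / 2]. *)
Lemma expR_le_quadratic (x : R) : `|x| <= 2^-1 -> expR x <= 1 + x + 2 * x ^+ 2.
Proof.
rewrite ler_norml => /andP[xl xu].
have := expR_ge1Dx (- x); rewrite expRN => h.
have e0 := expR_gt0 x.
have x1 : 0 < 1 - x by lra.
rewrite -(@ler_pM2l _ (1 - x))//; apply: (@le_trans _ _ 1).
  by rewrite -ler_pdivlMr// div1r.
rewrite -subr_ge0.
have -> : (1 - x) * (1 + x + 2 * x ^+ 2) - 1 = x ^+ 2 * (1 - 2 * x) by ring.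
by rewrite mulr_ge0 ?sqr_ge0// subr_ge0; lra.
Qed.

(** The generating function is 1 at [s = 0] and has slope [c - I < 0] there,
    where [I] is the mean information density; the quadratic bound on [expR]
    makes this quantitative without differentiating. *)
Lemma chernoff_factor_lt1 c :
  c < \sum_a \sum_b p a * W a b * info_density a b ->
  exists2 s, 0 < s & chernoff_factor c s < 1.
Proof.
set I := \sum_a _ => cI.
pose K := 1 + \sum_a \sum_b `|c - info_density a b|.
have leK a b : `|c - info_density a b| <= K.
  rewrite /K (bigD1 a)//= (bigD1 b)//= addrCA -addrA lerDl.
  by rewrite !addr_ge0 ?sumr_ge0// => i _; apply: sumr_ge0.
have K1 : 1 <= K by rewrite lerDl sumr_ge0// => a _; apply: sumr_ge0.
have K0 : 0 < K by lra.
have d0 : 0 < I - c by lra.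
(* The first bound keeps the exponents within 1 / 2, the second makes the
   quadratic term at most half of the linear gain s * (I - c). *)
pose s := Num.min (2 * K)^-1 ((I - c) / (4 * K ^+ 2)).
have s0 : 0 < s by rewrite lt_min invr_gt0 divr_gt0 ?mulr_gt0 ?exprn_gt0.
exists s => //.
have -> : 1 = 1 + s * (c - I) + s * (I - c) by ring.
have step a b : p a * W a b * expR (s * (c - info_density a b)) <=
   p a * W a b * (1 + s * c + 2 * s ^+ 2 * K ^+ 2) -
   s * (p a * W a b * info_density a b).
  have -> : p a * W a b * (1 + s * c + 2 * s ^+ 2 * K ^+ 2) -
     s * (p a * W a b * info_density a b) = p a * W a b *
     (1 + s * (c - info_density a b) + 2 * (s ^+ 2 * K ^+ 2)) by ring.
  apply: ler_wpM2l; first by rewrite mulr_ge0 ?pmass_ge0 ?trans_ge0.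
  apply: le_trans (expR_le_quadratic _) _.
    rewrite normrM gtr0_norm//; apply: (@le_trans _ _ ((2 * K)^-1 * K)).
      by apply: ler_pM => //; [exact: ltW|rewrite ge_min lexx].
    by rewrite invfM mulfVK// gt_eqF.
  rewrite lerD2l ler_pM2l// exprMn ler_pM2l ?exprn_gt0//.
  by rewrite -[leLHS]real_normK ?num_real// lerXn2r ?nnegrE// ltW.
apply: (@le_lt_trans _ _ (1 + s * c + 2 * s ^+ 2 * K ^+ 2 - s * I)).
  apply: (le_trans (ler_sum _ (fun a _ => ler_sum _ (fun b _ => step a b)))).
  under eq_bigr do rewrite sumrB -mulr_suml -[X in _ - X]mulr_sumr.
  by rewrite sumrB -mulr_suml -[X in _ - X]mulr_sumr sum_joint mul1r.
rewrite -subr_gt0.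
have -> : 1 + s * (c - I) + s * (I - c) - (1 + s * c + 2 * s ^+ 2 * K ^+ 2 - s * I)
   = s * (I - c - 2 * s * K ^+ 2) by ring.
rewrite mulr_gt0// subr_gt0.
have : s <= (I - c) / (4 * K ^+ 2) by rewrite ge_min lexx orbT.
rewrite ler_pdivlMr ?mulr_gt0 ?exprn_gt0// => h.
lra.
Qed.

(** On pairs of words of positive probability, a likelihood ratio at most
    [expR (n c)] means that the densities sum to at most [n c], so the indicator
    of this event is at most [expR (s * (n c - sum))], a product over the
    letters; its expectation factors. *)
Lemma chernoff_bound n c s : 0 < s ->
  low_density_mass (product_distribution n p) (product_channel n W)
    (expR (n%:R * c)) <= chernoff_factor c s ^+ n.
Proof.
move=> s0; rewrite /low_density_mass.
have -> : chernoff_factor c s ^+ n = \sum_(u : {ffun 'I_n -> A})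
    \sum_(v : {ffun 'I_n -> B}) \prod_i (p (u i) * W (u i) (v i) *
       expR (s * (c - info_density (u i) (v i)))).
  under eq_bigr => u _ do rewrite (sum_prod_ffun (fun i b => p (u i) * W (u i) b *
       expR (s * (c - info_density (u i) b)))).
  rewrite (sum_prod_ffun (fun _ a => \sum_b (p a * W a b *
       expR (s * (c - info_density a b))))).
  by rewrite prodr_const card_ord.
have ge0 (u : {ffun 'I_n -> A}) (v : {ffun 'I_n -> B}) : 0 <= \prod_i (p (u i) * W (u i) (v i) *
       expR (s * (c - info_density (u i) (v i)))).
  by apply: prodr_ge0 => i _; rewrite !mulr_ge0 ?pmass_ge0 ?trans_ge0 ?expR_ge0.
apply: ler_sum => u _; rewrite big_mkcond; apply: ler_sum => v _.
case: ifP => // low.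
rewrite /= -big_split/=.
have [[i pW0]|pos] := pselect (exists i, p (u i) * W (u i) (v i) = 0).
  by rewrite (bigD1 i)//= pW0 mul0r.
have {}pos i : p (u i) * W (u i) (v i) != 0.
  by apply/eqP => h; apply: pos; exists i.
rewrite [leRHS]big_split/= ler_peMr//.
  by apply: prodr_ge0 => i _; rewrite mulr_ge0 ?pmass_ge0 ?trans_ge0.
rewrite -expR_sum -[leLHS](@expR0 R) ler_expR -mulr_sumr pmulr_rge0//.
rewrite sumrB sumr_const card_ord -mulr_natl subr_ge0 -ler_expR expR_sum.
rewrite (eq_bigr (fun i => W (u i) (v i) / q (v i))); last first.
  move=> i _; have [? ?] := joint_gt0 (pos i).
  by rewrite /info_density lnK// posrE divr_gt0.
rewrite prodf_div ler_pdivrMr -?output_mass_product//.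
by rewrite output_mass_product prodr_gt0// => i _; have [] := joint_gt0 (pos i).
Qed.

End chernoff.

(** Feinstein's lemma on the product channel with threshold [expR (n c)], for a
    [c] strictly between the rate [r] and the mutual information, both in nats:
    the two error terms are then powers of numbers below 1. *)
Lemma channel_coding (R : realType) (A B : finType) (W : dmc R A B)
    (p : distribution_on R A) (r : R) :
  r < mutual_info (fun a b => p a * W a b) * ln 2 ->
  exists2 rho : R, 0 < rho < 1 &
  forall (n : nat) (T : finType) (t0 : T), #|T|%:R <= expR (n%:R * r) ->
  exists (word : T -> {ffun 'I_n -> A}) (dec : {ffun 'I_n -> B} -> T),
    forall t, \sum_(v | dec v != t) \prod_i W (word t i) (v i) <= 2 * rho ^+ n.
Proof.
rewrite -mutual_info_density => /midf_lt; set c := (_ / 2) => -[rc cI].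
have [s s0 lt1] := chernoff_factor_lt1 cI.
have e1 : expR (r - c) < 1 by rewrite -[ltRHS](@expR0 R) ltr_expR subr_lt0.
exists (Num.max (chernoff_factor p W c s) (expR (r - c))).
  by rewrite lt_max expR_gt0 orbT gt_max lt1 e1.
move=> n T t0 cardT; set rho := Num.max _ _.
apply: (@feinstein _ _ _ (product_distribution n p) (product_channel n W)
   (expR (n%:R * c))) => //; first exact: expR_gt0.
rewrite [leRHS]mulrDl mul1r; apply: lerD.
  apply: (@le_trans _ _ (expR (r - c) ^+ n)).
    rewrite -expRM_natl mulrBr expRB ler_pM2r// invr_gt0; exact: expR_gt0.
  by rewrite lerXn2r ?nnegrE ?le_max ?expR_ge0 ?lexx ?orbT.
apply: le_trans (chernoff_bound _ _ _ _ s0) _.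
have ch0 : 0 <= chernoff_factor p W c s.
  apply: sumr_ge0 => a _; apply: sumr_ge0 => b _.
  by rewrite !mulr_ge0 ?pmass_ge0 ?trans_ge0 ?expR_ge0.
by rewrite lerXn2r ?nnegrE ?le_max ?ch0 ?lexx.
Qed.

(** * Spanning sets and entropy *)

Section limn_esup_bounds.
Context {R : realType}.
Local Open Scope ereal_scope.
Implicit Types (u v : nat -> \bar R) (l : \bar R).

Lemma limn_esup_le_near u l :
  (\forall n \near \oo, u n <= l) -> limn_esup u <= l.
Proof.
move=> ul; apply: (@le_trans _ _ (ereal_sup (u @` [set n | u n <= l]))).
  by apply: ereal_inf_lbound; exists [set n | u n <= l].
by apply: ge_ereal_sup => _ [n /= unl <-].
Qed.

Lemma limn_esup_lt_near u l :
  limn_esup u < l -> \forall n \near \oo, u n < l.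
Proof.
move=> /ereal_inf_lt[_ [V Voo <-] supV]; apply: filterS Voo => n Vn.
by apply: le_lt_trans supV; apply: ereal_sup_ubound; exists n.
Qed.

Lemma le_limn_esup u v : (forall n, u n <= v n) -> limn_esup u <= limn_esup v.
Proof.
move=> uv; apply: le_ereal_inf_tmp => _ [V Voo <-].
apply: (@le_trans _ _ (ereal_sup (u @` V))).
  by apply: ereal_inf_lbound; exists V.
apply: ge_ereal_sup => _ [n Vn <-]; apply: le_trans (uv n) _.
by apply: ereal_sup_ubound; exists n.
Qed.

End limn_esup_bounds.

Section entropy_bounds.
Context {R : realType} {X : pmetricType R}.
Variable f : X -> X.

(** [X] is pointed, hence nonempty, so a spanning set is nonempty. *)
Lemma span_number_ge1 n e : (1 <= span_number f n e)%E.
Proof.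
apply: le_ereal_inf_tmp => _ [F /= Fspan <-].
rewrite lee_fin ler1n cardfs_gt0; have [y Fy _] := Fspan point.
by apply/fset0Pn; exists y.
Qed.

Lemma span_number_gt0 n e : (0 < span_number f n e)%E.
Proof. exact: lt_le_trans (span_number_ge1 n e). Qed.

Lemma span_rate_ge0 n : 0 <= (n%:R * ln (2 : R))^-1.
Proof. by rewrite invr_ge0 mulr_ge0// ln_ge0// ler1n. Qed.

Lemma le_lne_span n e e' : e <= e' ->
  (lne (span_number f n e') <= lne (span_number f n e))%E.
Proof.
move=> ee'; rewrite lee_lne ?in_itv/= ?leey ?andbT ?(ltW (span_number_gt0 _ _))//.
apply: le_ereal_inf_tmp => _ [F /= Fspan <-]; apply: ereal_inf_lbound.
exists F => //= x; have [y Fy close] := Fspan x.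
by exists y => // i /close /le_trans; exact.
Qed.

Lemma span_entropy_ge0 e : (0 <= span_entropy f e)%E.
Proof.
apply: limf_esup_ge0 => [[N _ /(_ N (leqnn N))]//|n].
apply: mule_ge0; first by rewrite lee_fin span_rate_ge0.
rewrite -[leLHS](@lne1 R) lee_lne ?in_itv/= ?leey ?andbT ?lee_fin ?ler01//.
  exact: span_number_ge1.
exact: ltW (span_number_gt0 _ _).
Qed.

(** The entropy at scale [e] increases as [e] decreases, so the limit at [0^'+]
    exists and is a supremum. *)
Lemma span_entropy_le_top e : 0 < e -> (span_entropy f e <= top_entropy f)%E.
Proof.
move=> e0; have := @nonincreasing_at_right_cvge R (span_entropy f) 0 +oo%O.
move=> /(_ isT) cvg_top; rewrite /top_entropy.
rewrite (cvg_lim _ (cvg_top _))//; last first.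
  move=> a b _ _ ab; apply: le_limn_esup => n; apply: lee_wpmul2l.
    by rewrite lee_fin span_rate_ge0.
  exact: le_lne_span.
by apply: ereal_sup_ubound; exists e => //=; rewrite in_itv/= e0.
Qed.

Lemma top_entropy_ge0 : (0 <= top_entropy f)%E.
Proof. exact: le_trans (span_entropy_ge0 1) (span_entropy_le_top ltr01). Qed.

(** The value [+oo] of [span_number], for lack of finite spanning sets, is
    excluded here by the finiteness of the growth rate. *)
Lemma small_spanning_sets (e c : R) : 0 < e -> (top_entropy f < c%:E)%E ->
  \forall n \near \oo, exists2 F : {fset X},
    is_spanning f n e [set` F] & #|` F|%fset%:R <= expR (n%:R * (c * ln 2)).
Proof.
move=> e0 topc; have := le_lt_trans (span_entropy_le_top e0) topc.
move=> /limn_esup_lt_near rate; near=> n.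
have n0 : (0 < n)%N by near: n; exact: nbhs_infty_gt.
have nln2 : 0 < n%:R * ln (2 : R) by rewrite mulr_gt0 ?ltr0n// ln_gt0// ltr1n.
have : (((n%:R * ln 2)^-1)%:E * lne (span_number f n e) < c%:E)%E by near: n.
move=> small.
have : (span_number f n e < (expR (n%:R * (c * ln 2)))%:E)%E.
  have := span_number_gt0 n e; case: (span_number f n e) small => [s| |]//=.
    move=> + s0; rewrite leNgt -lte_fin s0/= -EFinM lte_fin mulrC.
    rewrite ltr_pdivrMr// => lns; rewrite lte_fin -ltr_ln ?posrE ?expR_gt0//.
    by rewrite expRK mulrCA.
  by rewrite gt0_muley ?lte_fin ?invr_gt0// ltNge leey.
move=> /ereal_inf_lt[_ [F Fspan <-]]; rewrite lte_fin => /ltW cardF.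
by exists F.
Unshelve. all: by end_near. Qed.

End entropy_bounds.

(** * Borel sets and finitely valued random variables *)

Section borel.
Context {R : realType} {X : pmetricType R}.

Lemma closed_borel (C : set X) : closed C -> measurable (C : set (borel X)).
Proof.
move=> /closed_openC oC; rewrite -[C]setCK.
by apply: measurableC; exact: sub_sigma_algebra.
Qed.

Lemma continuous_iter (f : X -> X) n : continuous f -> continuous (iter n f).
Proof.
move=> cf; elim: n => [|n IHn] x; first exact: cvg_id.
by apply: continuous_comp; [exact: IHn|exact: cf].
Qed.

Lemma continuous_mdist (z : X) : continuous (fun x => mdist x z).
Proof.
move=> x; apply/cvgrPdist_le => /= e e0; near=> y.
have xy : mdist x y < e.
  by near: y; have := nbhsx_ballx x e e0; rewrite ballEmdist.
have := metric_triangle x y z; have := metric_triangle y x z.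
by rewrite (metric_sym y x) ler_norml => h1 h2; apply/andP; split; lra.
Unshelve. all: by end_near. Qed.

Lemma borel_continuous (f : X -> X) : continuous f ->
  measurable_fun setT (f : borel X -> borel X).
Proof.
move=> /continuousP cf; apply: (@measurability _ _ (borel X) (borel X) setT f (@open X)) => //.
move=> _ [U oU <-]; rewrite setTI; apply: sub_sigma_algebra; exact: cf.
Qed.

Lemma borel_continuous_real (g : X -> R) : continuous g ->
  measurable_fun setT (g : borel X -> R).
Proof.
move=> /continuousP cg; apply: (measurability _ (RGenOpens.measurableE R)).
move=> _ [_ [a [b ->] <-]]; rewrite setTI; apply: sub_sigma_algebra.
exact/cg/interval_open.
Qed.

End borel.

Section finite_valued.
Context {d : measure_display} {U : measurableType d}.

(** Choosing the first [t] in the enumeration of [T] with [C t x] is measurable: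
    the fibres are finite Boolean combinations of the [C t]. *)
Lemma measurable_finite_choice (T : finType) (t0 : T) (C : T -> set U) :
  (forall t, measurable (C t)) -> (forall x, exists t, C t x) ->
  exists2 g : U -> T, forall t, measurable [set x | g x = t] &
                      forall x, C (g x) x.
Proof.
move=> mC covC.
pose g s x := foldr (fun t t' => if `[< C t x >] then t else t') t0 s.
exists (g (enum T)) => [t|x].
  elim: (enum T) => [|u s IHs].
    by have [->|neq] := eqVneq t t0; [rewrite (_ : mkset _ = setT)|
      rewrite (_ : mkset _ = set0)] => //; apply/seteqP; split => // x /= /esym/eqP;
      rewrite (negPf neq).
  have -> : [set x | g (u :: s) x = t] =
      (if u == t then C u else set0) `|` (~` C u `&` [set x | g s x = t]).
    apply/seteqP; split => x /=.
      by case: asboolP => Cux /= ut; [left; rewrite ut eqxx -ut|right].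
    by case: eqVneq => [<-|_] [Cux|[nCux gt]]; case: asboolP.
  apply: measurableU; first by case: ifP.
  by apply: measurableI => //; exact: measurableC.
have [t Ct] := covC x; have := mem_enum T t; rewrite inE.
elim: (enum T) => // u s IHs; rewrite inE /= => /orP[/eqP<-|/IHs Cg].
  by case: asboolP.
by case: asboolP.
Qed.

Lemma measurable_finite_cases (T : finType) (g : U -> T) (C : T -> set U) :
  (forall t, measurable [set x | g x = t]) -> (forall t, measurable (C t)) ->
  measurable [set x | C (g x) x].
Proof.
move=> mg mC.
have -> : [set x | C (g x) x] =
    \bigcup_(t in [set: T]) ([set x | g x = t] `&` C t).
  by apply/seteqP; split => [x Cx|x [t _ [/= <-]]//]; exists (g x).
by apply: fin_bigcup_measurable => // t _; exact: measurableI.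
Qed.

Lemma measurable_finite_preimage (T : finType) (g : U -> T) (Q : set T) :
  (forall t, measurable [set x | g x = t]) -> measurable [set x | Q (g x)].
Proof.
move=> mg; apply: (measurable_finite_cases (C := fun t => [set _ | Q t])) => // t.
have [Qt|nQt] := pselect (Q t).
  by rewrite (_ : mkset _ = setT)//; apply/seteqP; split.
by rewrite (_ : mkset _ = set0)//; apply/seteqP; split.
Qed.

Lemma measure_split {R : realType} (P : {measure set U -> \bar R})
    (T : finType) (g : U -> T) (S : set U) :
  (forall t, measurable [set x | g x = t]) -> measurable S ->
  P S = (\sum_t P (S `&` [set x | g x = t]))%E.
Proof.
move=> mg mS.
have -> : P S = P (\bigcup_(t in [set: T]) (S `&` [set x | g x = t])).
  congr (P _); apply/seteqP; split => [x Sx|x [t _ []//]].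
  by exists (g x).
have finT : finite_set [set: T] by exact: finite_finset.
rewrite measure_fin_bigcup//; last 2 first.
- by move=> t t' _ _ [x [[_ /= <-] [_ /= <-]]].
- by move=> t _; exact: measurableI.
rewrite fsbig_finite//=; apply/perm_big/uniq_perm => [||t].
- exact: fset_uniq.
- exact: index_enum_uniq.
- by rewrite mem_index_enum in_fset_set//; exact/mem_set.
Qed.

End finite_valued.

(** * Law of the closed loop over a block *)

Section letters.
Context {T : Type} (t0 : T) {n : nat}.

(** Words extended by [t0] beyond their end, so that positions in a block can be
    plain natural numbers. *)
Definition letter (w : 'I_n -> T) (j : nat) : T :=
  if insub j is Some i then w i else t0.

Lemma letterE (w : 'I_n -> T) (i : 'I_n) : letter w i = w i.
Proof. by rewrite /letter valK. Qed.

End letters.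

Section closed_loop_law.
Context {R : realType} {X : pmetricType R} {A B : finType}.
Variables (f : X -> X) (mu : probability (borel X) R) (W : dmc R A B).
Variable enc : coding_policy X A B.
Context {d : measure_display} {Omega : measurableType d}.
Variables (P : probability Omega R) (x0 : {RV P >-> borel X}).
Variable y : nat -> Omega -> B.
Hypothesis run : closed_loop f mu W enc x0 y.

Lemma measurable_initial (E : set (borel X)) :
  measurable E -> measurable [set w | E (x0 w)].
Proof. by move=> mE; exact: measurable_funPTI. Qed.

Lemma measurable_word n (F : 'I_n -> nat) (v : 'I_n -> B) :
  measurable [set w | forall i, y (F i) w = v i].
Proof.
have -> : [set w | forall i, y (F i) w = v i] =
    \bigcap_(i in [set: 'I_n]) [set w | y (F i) w = v i].
  by apply/seteqP; split => [w H i _|w H i]; [exact: H|exact: (H i I)].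
apply: fin_bigcap_measurable => [|i _]; first exact: finite_finset.
exact: (measurable_output run).
Qed.

Lemma measurable_outputs t (v : t.-tuple B) :
  measurable [set w | outputs y t w = v].
Proof.
rewrite [X in measurable X](_ : _ = [set w | forall i : 'I_t, y i w = tnth v i]).
  exact: (measurable_word (fun i => i)).
apply/seteqP; split => w /=.
  by move=> <- i; rewrite tnth_mktuple.
by move=> H; apply: eq_from_tnth => i; rewrite tnth_mktuple.
Qed.

(** The axiom [memoryless] conditions on the exact past outputs and input; summing
    it over the pasts gives the same law conditionally on any event about [x0]
    and the past outputs on which the input is constant. *)
Lemma next_output (E : set (borel X)) t (a : A) (b : B) (Q : set (t.-tuple B)) :
  measurable E -> (forall w, E (x0 w) -> channel_input f enc x0 y t w = a) ->
  P [set w | [/\ E (x0 w), Q (outputs y t w) & y t w = b]] =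
  ((W a b)%:E * P [set w | E (x0 w) /\ Q (outputs y t w)])%E.
Proof.
move=> mE inputE.
have mEQ : measurable [set w | E (x0 w) /\ Q (outputs y t w)].
  apply: measurableI; first exact: measurable_initial.
  exact: (measurable_finite_preimage _ (@measurable_outputs t)).
have mEQb : measurable [set w | [/\ E (x0 w), Q (outputs y t w) & y t w = b]].
  rewrite [X in measurable X](_ : _ =
    [set w | E (x0 w) /\ Q (outputs y t w)] `&` [set w | y t w = b]).
    by apply: measurableI => //; exact: (measurable_output run).
  by apply/seteqP; split => w /= [] => [|[]].
rewrite (measure_split P (@measurable_outputs t) mEQ).
rewrite (measure_split P (@measurable_outputs t) mEQb).
rewrite ge0_sume_distrr => [|v _]; last exact: measure_ge0.
apply: eq_bigr => v _.
have [Qv|nQv] := pselect (Q v); last first.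
  have null S : (forall w, S w -> Q (outputs y t w)) ->
      S `&` [set w | outputs y t w = v] = set0.
    by move=> SQ; apply/seteqP; split => w //= [/SQ + ov]; rewrite ov.
  by rewrite !null ?measure0 ?mule0// => w [].
have /= := memoryless run v a b mE.
have -> : [set w | E (x0 w) /\ Q (outputs y t w)] `&`
    [set w | outputs y t w = v] =
    [set w | [/\ E (x0 w), outputs y t w = v & channel_input f enc x0 y t w = a]].
  apply/seteqP; split => w /=.
    by move=> [[Ew _] ov]; split => //; exact: inputE.
  by move=> [Ew ov _]; rewrite ov.
move=> <-; congr (P _); apply/seteqP; split => w /=.
  by move=> [[Ew _ yb] ov]; split => //; split => //; exact: inputE.
by move=> [[Ew ov _] yb]; rewrite ov.
Qed.

(** If the inputs of a block are constant on [E], then the outputs of the block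
    are those of the product channel, independently of [x0] within [E]. *)
Lemma block_law (E : set (borel X)) (t0 n : nat) (a : nat -> A) (b : nat -> B) :
  measurable E ->
  (forall w i, (i < n)%N -> E (x0 w) ->
     channel_input f enc x0 y (t0 + i) w = a i) ->
  P [set w | E (x0 w) /\ forall i, (i < n)%N -> y (t0 + i)%N w = b i] =
  ((\prod_(i < n) W (a i) (b i))%:E * mu E)%E.
Proof.
move=> mE; elim: n => [_|n IHn inputE].
  rewrite big_ord0 mul1e -(initial_law run mE); congr (P _).
  by apply/seteqP; split => w /=; [case|split].
rewrite big_ord_recr/= [(_ * W _ _)%R]mulrC EFinM -muleA -IHn; last first.
  by move=> w i /ltnW; exact: inputE.
pose Q : set ((t0 + n).-tuple B) :=
  [set v | forall i, (i < n)%N -> nth (b 0%N) v (t0 + i) = b i].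
have QE w : Q (outputs y (t0 + n) w) <->
    forall i, (i < n)%N -> y (t0 + i)%N w = b i.
  by split=> H i ltin; have := H i ltin; rewrite (nth_mktuple _ _ (Ordinal (_ : t0 + i < t0 + n)%N))//=
     ?ltn_add2l.
rewrite [X in (_ * P X)%E](_ : _ = [set w | E (x0 w) /\ Q (outputs y (t0 + n) w)]).
  rewrite -next_output//; last by move=> w; apply: inputE.
  congr (P _); apply/seteqP; split => w /=.
    move=> [Ew H]; split=> //; last exact: H.
    by apply/QE => i /ltnW; exact: H.
  move=> [Ew /QE H yb]; split=> // i; rewrite ltnS leq_eqVlt => /orP[/eqP->//|].
  exact: H.
by apply/seteqP; split => w /= [Ew /QE].
Qed.

(** A union over messages [m]: on the event [g x0 = m] the block carries the word
    of [m], so [block_law] turns the error of the code for [m] into a conditional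
    probability of failure, whatever the law of the message is. *)
Lemma decoding_error (a0 : A) (b0 : B) (t0 n : nat) (M : finType) (g : borel X -> M)
    (word : M -> {ffun 'I_n -> A}) (dec : {ffun 'I_n -> B} -> M) (eps : R) :
  (forall m, measurable [set x | g x = m]) ->
  (forall w (i : 'I_n), channel_input f enc x0 y (t0 + i) w = word (g (x0 w)) i) ->
  (forall m, \sum_(v | dec v != m) \prod_i W (word m i) (v i) <= eps) ->
  let failure :=
    [set w | dec [ffun i : 'I_n => y (t0 + i)%N w] <> g (x0 w)] in
  measurable failure /\ (P failure <= eps%:E)%E.
Proof.
move=> mg inputE err failure.
pose block w := [ffun i : 'I_n => y (t0 + i)%N w].
have blockE w v : block w = v <-> forall i : 'I_n, y (t0 + i)%N w = v i.
  split=> [<- i|H]; first by rewrite ffunE.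
  by apply/ffunP => i; rewrite ffunE.
have mblock v : measurable [set w | block w = v].
  rewrite [X in measurable X](_ : _ = [set w | forall i : 'I_n, y (t0 + i)%N w = v i]).
    exact: (measurable_word (fun i => (t0 + i)%N)).
  by apply/seteqP; split => w /blockE.
have mgx m : measurable [set w | g (x0 w) = m] by exact: (measurable_initial (mg m)).
have mfail : measurable failure.
  apply: (measurable_finite_cases (g := block) (C := fun v => [set w | dec v <> g (x0 w)])) => // v.
  exact: (measurable_finite_preimage (fun m => dec v <> m)).
split=> //.
rewrite (measure_split P mgx mfail).
apply: (@le_trans _ _ (\sum_m (eps%:E * mu [set x | g x = m])))%E; last first.
  rewrite -ge0_sume_distrr => [|m _]; last exact: measure_ge0.
  rewrite [X in (_ * X)%E](_ : _ = 1%E) ?mule1// -(probability_setT mu).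
  rewrite (measure_split mu mg measurableT).
  by apply: eq_bigr => m _; rewrite setTI.
apply: lee_sum => m _.
rewrite (measure_split P mblock); last exact: measurableI.
apply: (@le_trans _ _ (\sum_(v | dec v != m)
   ((\prod_i W (word m i) (v i))%:E * mu [set x | g x = m])))%E; last first.
  rewrite -ge0_sume_distrl => [|v _]; last first.
    by rewrite lee_fin; apply: prodr_ge0 => i _; exact: trans_ge0.
  by apply: lee_wpmul2r; [exact: measure_ge0|rewrite sumEFin lee_fin].
rewrite [leRHS]big_mkcond/=; apply: lee_sum => v _.
case: ifPn => [_|/negPn/eqP decv]; last first.
  rewrite (_ : _ `&` _ = set0) ?measure0//; apply/seteqP; split=> w //=.
  by move=> [[fail gm] bv]; apply: fail; rewrite -/(block w) bv gm.
rewrite (eq_bigr (fun i : 'I_n => W (letter a0 (word m) i) (letter b0 v i))).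
  2: by move=> i _; rewrite !letterE.
rewrite -(@block_law _ t0) => [||w i ltin /= gm]; [|exact: mg|]; last first.
  by rewrite (inputE w (Ordinal ltin)) gm -(letterE a0 (word m) (Ordinal ltin)).
rewrite le_measure ?inE//.
- apply: measurableI => //; exact: measurableI.
- apply: measurableI; first exact: mgx.
  have := measurable_word (fun i : 'I_n => (t0 + i)%N) v.
  congr measurable; apply/seteqP; split => w /= H i.
    by move=> ltin; rewrite (H (Ordinal ltin)) -(letterE b0 v (Ordinal ltin)).
  by rewrite H// letterE.
- move=> w /= [[_ gm] /blockE bv]; split=> // i ltin.
  by rewrite (bv (Ordinal ltin)) -(letterE b0 v (Ordinal ltin)).
Qed.

End closed_loop_law.

(** * Division of time into blocks *)

Section clock.
Variable len : nat -> nat.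
Hypothesis len_gt0 : forall k, (0 < len k)%N.

Definition block_start (k : nat) : nat := (\sum_(i < k) len i)%N.

Lemma block_startS k : block_start k.+1 = (block_start k + len k)%N.
Proof. by rewrite /block_start big_ord_recr. Qed.

(** The index of the block that contains time [t] and the position in it. *)
Fixpoint clock (t : nat) : nat * nat :=
  if t is s.+1 then
    let: (k, j) := clock s in
    if (j.+1 < len k)%N then (k, j.+1) else (k.+1, 0%N)
  else (0%N, 0%N).

Lemma clockK t : ((clock t).2 < len (clock t).1)%N /\
  t = (block_start (clock t).1 + (clock t).2)%N.
Proof.
elim: t => [|t]; first by rewrite /block_start big_ord0.
rewrite /=; case: (clock t) => k j /= [ltj ->].
have [ltSj|lej] := ltnP j.+1 (len k); first by rewrite addnS.
by rewrite len_gt0 block_startS addn0 -addnS (@anti_leq j.+1 (len k)) ?ltj.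
Qed.

Lemma clock_block k j : (j < len k)%N -> clock (block_start k + j) = (k, j).
Proof.
elim: k j => [|k IHk]; elim=> [|j IHj] ltj.
- by rewrite /block_start big_ord0.
- by rewrite addnS /= IHj ?ltj// ltnW.
- rewrite addn0 block_startS -(prednK (len_gt0 k)) addnS /= IHk ?prednK//.
  by rewrite ltnn.
- by rewrite addnS /= IHj ?ltj// ltnW.
Qed.

End clock.

(** * Codes for one block *)

Section scheme.
Context {R : realType} {X : pmetricType R} {A B : finType}.
Variables (f : X -> X) (W : dmc R A B).

(** A code for one block: [quantize] describes the orbit of a state over [m] steps
    up to [e] by one of finitely many messages, each of which is sent over [n]
    channel uses with error probability at most [eps]. *)
Record block_scheme (n m : nat) (e eps : R) := BlockScheme {
  message : finType ;
  quantize : borel X -> message ;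
  cell_point : message -> X ;
  codeword : message -> {ffun 'I_n -> A} ;
  decode_block : {ffun 'I_n -> B} -> message ;
  measurable_quantize : forall k, measurable [set x | quantize x = k] ;
  close_cell_point : forall x i, (i < m)%N ->
    mdist (iter i f x) (iter i f (cell_point (quantize x))) <= e ;
  decode_error : forall k,
    \sum_(v | decode_block v != k) \prod_i W (codeword k i) (v i) <= eps }.


(** With [n] channel uses for [n.+1] steps: given
    entropy < c < r < mutual information, a spanning set of size
    2 ^ ((n + 1) c) is at most 2 ^ (n r) for large [n], within reach of
    [channel_coding]. *)
Lemma block_schemes (e : R) : continuous f -> 0 < e ->
  (top_entropy f < capacity W)%E ->
  exists2 rho : R, 0 < rho < 1 &
  \forall n \near \oo, inhabited (block_scheme n n.+1 e (2 * rho ^+ n)).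
Proof.
move=> cf e0 /ereal_sup_gt[_ [p _ <-] topI].
set I := mutual_info _ in topI.
have topfin : top_entropy f \is a fin_num.
  by rewrite ge0_fin_numE ?(lt_trans topI) ?ltry// top_entropy_ge0.
have ln2 : 0 < ln (2 : R) by rewrite ln_gt0// ltr1n.
have topI' : fine (top_entropy f) < I by rewrite -lte_fin fineK.
have [hc cI] := midf_lt topI'; set c := (_ / 2) in hc cI.
have [cr rI] := midf_lt cI; set r := (_ / 2) in cr rI.
have topc : (top_entropy f < c%:E)%E by rewrite -[ltLHS]fineK// lte_fin.
have [|rho rho01 coding] := @channel_coding R A B W p (r * ln 2).
  by rewrite ltr_pM2r.
exists rho => //.
have [N _ spanN] := small_spanning_sets e0 topc.
near=> n.
have [|F Fspan cardF] := spanN n.+1.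
  by apply: leqW; near: n; exact: nbhs_infty_ge.
have [y0 Fy0 _] := Fspan point.
have [|word [dec err]] := coding n F [` Fy0]%fset.
  rewrite cardfE in cardF; apply: le_trans cardF _.
  have cn : c <= n%:R * (r - c).
    rewrite -ler_pdivrMr ?subr_gt0//; near: n; exact: nbhs_infty_ger.
  rewrite ler_expR (mulrA _ c) (mulrA _ r) ler_pM2r// -natr1.
  by move: cn; rewrite mulrBr mulrDl mul1r lerBrDl.
have [||q mq closeq] := @measurable_finite_choice _ (borel X) F [` Fy0]%fset
  (fun y => [set x | forall i, (i < n.+1)%N ->
     mdist (iter i f x) (iter i f (val y)) <= e]).
- move=> y; rewrite [X in measurable X](_ : _ = \bigcap_(i in [set i | (i < n.+1)%N])
    [set x | mdist (iter i f x) (iter i f (val y)) <= e]).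
    apply: bigcap_measurable => [|i _]; first by exists 0%N.
    apply: closed_borel.
    apply: (@closed_comp _ _ (fun x => mdist (iter i f x) (iter i f (val y)))
      [set z | z <= e]); last exact: closed_le.
    move=> x _; apply: (@continuous_comp _ _ _ (iter i f)
      (fun x => mdist x (iter i f (val y)))).
      exact: continuous_iter.
    exact: continuous_mdist.
  by apply/seteqP; split.
- move=> x; have [y Fy close] := Fspan x.
  by exists [` Fy]%fset.
by constructor; exact: (BlockScheme mq closeq err).
Unshelve. all: by end_near. Qed.

End scheme.

Arguments quantize {R X A B f W n m e eps} b.
Arguments cell_point {R X A B f W n m e eps} b.
Arguments codeword {R X A B f W n m e eps} b.
Arguments decode_block {R X A B f W n m e eps} b.
Arguments measurable_quantize {R X A B f W n m e eps} b.
Arguments close_cell_point {R X A B f W n m e eps} b.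
Arguments decode_error {R X A B f W n m e eps} b.

(** * The tracking scheme *)

Section tracking.
Context {R : realType} {X : pmetricType R} {A B : finType}.
Variables (f : X -> X) (W : dmc R A B) (cf : continuous f).
Variables (a0 : A) (b0 : B) (e : R) (len : nat -> nat) (eps : nat -> R).
Hypothesis len_gt0 : forall k, (0 < len k)%N.
Variable S : forall k, block_scheme f W (len k) (len k.+1) e (eps k).

(** Block [k] describes the orbit over block [k.+1], hence the state at the start
    of the latter. *)
Definition block_message k (x : borel X) : message (S k) :=
  quantize (S k) (iter (block_start len k.+1) f x).

Lemma measurable_block_message k m : measurable [set x | block_message k x = m].
Proof.
have mf : measurable_fun setT (iter (block_start len k.+1) f : borel X -> borel X).
  by apply: borel_continuous; exact: continuous_iter.
have := mf measurableT _ (measurable_quantize (S k) m).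
by rewrite setTI.
Qed.

(** The input is a function of time and [x_0] alone, hence constant on the events
    about [x_0] that fix the message, as [block_law] requires. *)
Definition tracking_letter t (x : borel X) : A :=
  let: (k, j) := clock len t in letter a0 (codeword (S k) (block_message k x)) j.

Program Definition tracking_encoder : coding_policy X A B :=
  @CodingPolicy R X A B (fun t u _ => tracking_letter t (thead u)) _.
Next Obligation.
move=> t v a; rewrite /tracking_letter; case: (clock len t) => k j.
have mE : measurable [set x | letter a0 (codeword (S k) (block_message k x)) j = a].
  exact: (measurable_finite_preimage (fun m => letter a0 (codeword (S k) m) j = a)
    (@measurable_block_message k)).
by have := @measurable_tnth _ (borel X) t.+1 ord0 measurableT _ mE; rewrite setTI.
Qed.

Definition tracking_estimator : estimation_policy X B := fun t v =>
  let: (k, j) := clock len t in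
  if k is l.+1 then
    iter j f (cell_point (S l) (decode_block (S l)
      [ffun i : 'I_(len l) => nth b0 v (block_start len l + i)]))
  else point.

Context {d : measure_display} {Omega : measurableType d}.
Variables (mu : probability (borel X) R) (P : probability Omega R).
Variables (x0 : {RV P >-> borel X}) (y : nat -> Omega -> B).
Hypothesis run : closed_loop f mu W tracking_encoder x0 y.

Definition block_failure k : set Omega :=
  [set w | decode_block (S k) [ffun i : 'I_(len k) => y (block_start len k + i)%N w]
           <> block_message k (x0 w)].

Lemma block_failureP k :
  measurable (block_failure k) /\ (P (block_failure k) <= (eps k)%:E)%E.
Proof.
apply: (decoding_error run a0 b0 (word := codeword (S k))).
- exact: measurable_block_message.
- move=> w i; rewrite /channel_input /= /tracking_letter.
  by rewrite clock_block// letterE /thead tnth_mktuple.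
- exact: decode_error.
Qed.

Lemma tracking_close t l w : (clock len t).1 = l.+1 -> ~ block_failure l w ->
  mdist (state f x0 t w) (estimate tracking_estimator y t w) <= e.
Proof.
have [] := clockK len_gt0 t; rewrite /estimate /tracking_estimator.
case: (clock len t) => k j /= + tE kl; rewrite kl in tE *; move=> ltj /contrapT ok.
have -> : [ffun i : 'I_(len l) => nth b0 (outputs y t.+1 w) (block_start len l + i)]
   = [ffun i : 'I_(len l) => y (block_start len l + i)%N w].
  apply/ffunP => i; rewrite !ffunE.
  have lt : (block_start len l + i < t.+1)%N.
    rewrite tE block_startS ltnS -addnA leq_add2l.
    exact: leq_trans (ltnW (ltn_ord i)) (leq_addr _ _).
  exact: (nth_mktuple (fun i : 'I_t.+1 => y i w) b0 (Ordinal lt)).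
rewrite ok /state tE addnC iterD.
exact: close_cell_point.
Qed.

End tracking.

Section distance.
Context {R : realType} {X : pmetricType R} {A B : finType}.
Variables (f : X -> X) (mu : probability (borel X) R) (W : dmc R A B).
Variables (enc : coding_policy X A B) (dec : estimation_policy X B).
Context {d : measure_display} {Omega : measurableType d}.
Variables (P : probability Omega R) (x0 : {RV P >-> borel X}).
Variable y : nat -> Omega -> B.
Hypothesis run : closed_loop f mu W enc x0 y.

(** The estimate takes finitely many values, so it suffices to consider the
    distance to a fixed point. *)
Lemma measurable_distance t : continuous f ->
  measurable_fun setT (fun w => mdist (state f x0 t w) (estimate dec y t w)).
Proof.
move=> cf _ Y mY; rewrite setTI.
pose C v := [set w | Y (mdist (iter t f (x0 w)) (@dec t v))].
have := @measurable_finite_cases _ Omega _ (outputs y t.+1) C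
  (fun v => measurable_outputs run v); apply => v.
have mfun : measurable_fun setT
    ((fun x => mdist (iter t f x) (@dec t v)) : borel X -> R).
  apply: borel_continuous_real => x.
  apply: (@continuous_comp _ _ _ (iter t f) (fun x => mdist x (@dec t v))).
    exact: continuous_iter.
  exact: continuous_mdist.
have := mfun measurableT _ mY; rewrite setTI.
exact: measurable_initial.
Qed.

End distance.

Lemma compact_mdist_bounded (R : realType) (X : pmetricType R) :
  compact [set: X] -> exists D : R, forall x z : X, mdist x z <= D.
Proof.
move=> cptX.
have cpt : compact ((fun x => mdist x (point : X)) @` [set: X]).
  apply: continuous_compact => //.
  exact/continuous_subspaceT/continuous_mdist.
have [M [_ bdd]] := compact_bounded cpt.
exists ((M + 1) + (M + 1)) => x z; apply: le_trans (metric_triangle x point z) _.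
have le1 u : mdist u (point : X) <= M + 1.
  have := bdd (M + 1); rewrite ltrDl => /(_ ltr01 (mdist u point)).
  by rewrite /= ger0_norm ?mdist_ge0//; apply; exists u.
by apply: lerD => //; rewrite metric_sym.
Qed.

(** What the objectives need to know of a scheme: at time [t] the estimate is
    [e]-close unless the block [block t] has failed, and failures of the blocks
    have geometrically small probability. *)
Definition reliable {R : realType} {X : pmetricType R} (f : X -> X)
    (mu : probability (borel X) R) {A B : finType} (W : dmc R A B)
    (enc : coding_policy X A B) (dec : estimation_policy X B) (e rho : R) : Prop :=
  exists2 block : nat -> nat, (forall K, \forall t \near \oo, (K <= block t)%N) &
  forall (d : measure_display) (Omega : measurableType d)
    (P : probability Omega R) (x0 : {RV P >-> borel X}) (y : nat -> Omega -> B),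
    closed_loop f mu W enc x0 y ->
    exists2 failure : nat -> set Omega,
      forall k, measurable (failure k) /\ (P (failure k) <= (2 * rho ^+ k)%:E)%E &
      \forall t \near \oo, forall w, ~ failure (block t) w ->
        mdist (state f x0 t w) (estimate dec y t w) <= e.

(** Blocks have lengths [N.+1], [N.+2], ..., where [N] is large enough for
    [block_schemes]; at time [t] the relevant failure is that of the block before
    the current one, which exists once block 0 is over. *)
Lemma reliable_tracking (R : realType) (X : pmetricType R) (f : X -> X)
    (mu : probability (borel X) R) (A B : finType) (W : dmc R A B) (e : R) :
  continuous f -> 0 < e -> (top_entropy f < capacity W)%E ->
  exists enc : coding_policy X A B, exists dec : estimation_policy X B,
  exists2 rho : R, 0 < rho < 1 & reliable f mu W enc dec e rho.
Proof.
move=> cf e0 topW.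
have [p _] : exists p : distribution_on R A, True.
  by have /ereal_sup_gt[_ [p _ _] _] := topW; exists p.
have [a0 _] : exists a0 : A, (0 : R) <= 0.
  by apply: (exists_le_average (p := p)); rewrite big1// => a _; rewrite mulr0.
have [b0 _] : exists b0 : B, True.
  apply: contrapT => noB; have := trans_sum1 W a0; rewrite big1; last first.
    by move=> b _; case: noB; exists b.
  by move/eqP; rewrite eq_sym oner_eq0.
have [rho rho01 [N _ schemes]] := block_schemes cf e0 topW.
pose len k := (k + N).+1.
have S k : block_scheme f W (len k) (len k.+1) e (2 * rho ^+ len k).
  apply: (@sval _ (fun=> True)); apply: cid.
  have [|s] := schemes (len k); first by rewrite /= leqW// leq_addl.
  by exists s.
have len_gt0 k : (0 < len k)%N by [].
exists (tracking_encoder cf a0 S), (tracking_estimator b0 S), rho => //.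
exists (fun t => (clock len t).1.-1) => [K|d Omega P x0 y run].
  near=> t.
  have big : (block_start len K.+2 <= t)%N by near: t; exact: nbhs_infty_ge.
  have [ltj tE] := clockK len_gt0 t; rewrite leqNgt; apply/negP => small.
  move: big; rewrite leqNgt tE => /negP; apply.
  apply: (@leq_trans (block_start len (clock len t).1.+1)).
    by rewrite block_startS ltn_add2l.
  have mono : {homo block_start len : m n / (m <= n)%N}.
    by apply: homo_leq leqnn leq_trans _ => m; rewrite block_startS leq_addr.
  by apply: mono; case: (clock len t).1 small => [|k]//=; rewrite !ltnS => /ltnW.
exists (block_failure S x0 y) => [k|].
  have [mfail le_eps] := block_failureP b0 len_gt0 run k; split => //.
  apply: le_trans le_eps _; rewrite lee_fin ler_pM2l//.
  case/andP: rho01 => rho0 /ltW rho1.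
  by apply: (ler_wiXn2l (ltW rho0) rho1); apply: leqW; exact: leq_addr.
near=> t => w /= ok.
have pos : (0 < (clock len t).1)%N.
  rewrite lt0n; apply/negP => /eqP t0.
  have [ltj tE] := clockK len_gt0 t; rewrite t0 in ltj tE.
  have : (len 0 <= t)%N by near: t; exact: nbhs_infty_ge.
  by rewrite tE /block_start big_ord0 add0n leqNgt ltj.
by apply: (tracking_close b0 len_gt0 _ ok); rewrite prednK.
Unshelve. all: by end_near. Qed.

Section objectives.
Context {R : realType} {X : pmetricType R} {A B : finType}.
Variables (f : X -> X) (mu : probability (borel X) R) (W : dmc R A B).
Variables (enc : coding_policy X A B) (dec : estimation_policy X B).
Variables (e rho : R).
Hypotheses (cf : continuous f) (rho01 : 0 < rho < 1).
Hypothesis rel : reliable f mu W enc dec e rho.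

(** Borel-Cantelli on the block failures. *)
Lemma reliable_E2 : achieves f mu (@objective_E2 R X) W enc dec e.
Proof.
move=> d Omega P x0 y run; rewrite /objective_E2.
have [block blockoo /(_ _ _ _ _ _ run)[fail failP close]] := rel.
have [rho0 rho1] := andP rho01.
set G := [set w | _].
have mG : measurable G.
  rewrite -[G]setTI; apply: emeasurable_fun_infty_c => //.
  apply: measurable_fun_limn_esup => t; apply/measurable_EFinP.
  exact: measurable_distance run t cf.
have mfail k : measurable (fail k) by have [] := failP k.
have null : P (lim_sup_set fail) = 0%E.
  apply: lim_sup_set_cvg0 => //.
  apply: (@le_lt_trans _ _ (2 * (1 - rho)^-1)%:E); last exact: ltry.
  apply: lime_le; first by apply: is_cvg_nneseries => n _ _; exact: measure_ge0.
  apply: nearW => n.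
  apply: (@le_trans _ _ (series (geometric 2 rho) n)%:E).
    rewrite /series/= -sumEFin; apply: lee_sum => k _.
    by have [] := failP k.
  rewrite lee_fin; apply: geometric_le_lim => //.
  by rewrite ger0_norm// ltW.
have mlim : measurable (lim_sup_set fail).
  by apply: bigcap_measurable => [|n _]; [exists 0%N|exact: bigcup_measurable].
have sub : ~` lim_sup_set fail `<=` G.
  move=> w /existsNP[K /not_implyP[_ nfail]].
  apply: limn_esup_le_near; near=> t; rewrite lee_fin.
  have close_t : forall w, ~ fail (block t) w ->
    mdist (state f x0 t w) (estimate dec y t w) <= e by near: t.
  apply: close_t => fw; apply: nfail; exists (block t) => //=.
  by near: t; exact: blockoo.
apply/eqP; rewrite eq_le probability_le1//=.
apply: (@le_trans _ _ (P (~` lim_sup_set fail))).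
  by rewrite probability_setC// null sube0.
by apply: le_measure => //; rewrite inE//; exact: measurableC.
Unshelve. all: by end_near. Qed.

(** The squared error is at most [e ^+ 2] off the failure and [D ^+ 2] on it,
    where [D] bounds the metric. *)
Lemma reliable_E3 (e' : R) : compact [set: X] -> e ^+ 2 < e' ->
  achieves f mu (@objective_E3 R X) W enc dec e'.
Proof.
move=> cptX ee' d Omega P x0 y run; rewrite /objective_E3.
have [block blockoo /(_ _ _ _ _ _ run)[fail failP close]] := rel.
have [rho0 rho1] := andP rho01.
have [D leD] := compact_mdist_bounded cptX.
have D0 : 0 <= D by rewrite -(mdistxx (point : X)).
have [K _ smallK] : \forall k \near \oo, D ^+ 2 * (2 * rho ^+ k) < e' - e ^+ 2.
  have := @cvg_geometric R (D ^+ 2 * 2) rho; rewrite ger0_norm ?ltW// => /(_ rho1).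
  move=> /cvgrPdist_lt /(_ (e' - e ^+ 2)); rewrite subr_gt0 => /(_ ee').
  apply: filterS => k /=; rewrite sub0r normrN mulrA; exact: le_lt_trans (ler_norm _).
apply: limn_esup_le_near; near=> t.
have close_t : forall w, ~ fail (block t) w ->
  mdist (state f x0 t w) (estimate dec y t w) <= e by near: t.
have [mfail failrho] := failP (block t).
set dist := fun w => mdist (state f x0 t w) (estimate dec y t w).
have mdist_t : measurable_fun setT dist by exact: measurable_distance run t cf.
have mind : measurable_fun setT (fun w => (\1_(fail (block t)) w)%:E : \bar R).
  by apply/measurable_EFinP; exact: measurable_indic.
have dist0 w : 0 <= dist w by exact: mdist_ge0.
have distD w : dist w <= D by exact: leD.
have bound w : dist w ^+ 2 <= e ^+ 2 + D ^+ 2 * \1_(fail (block t)) w.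
  have [fw|nfw] := pselect (fail (block t) w).
    rewrite indicE mem_set// mulr1 (@le_trans _ _ (D ^+ 2))//.
      by rewrite lerXn2r ?nnegrE ?dist0 ?D0 ?distD.
    by rewrite lerDr sqr_ge0.
  have dist_e : dist w <= e by exact: close_t.
  by rewrite indicE memNset// mulr0 addr0 lerXn2r ?nnegrE// (le_trans (dist0 w)).
rewrite unlock.
apply: (@le_trans _ _ (\int[P]_w ((e ^+ 2)%:E + (D ^+ 2)%:E * (\1_(fail (block t)) w)%:E)))%E.
  apply: ge0_le_integral => //.
  - by move=> w _; rewrite lee_fin sqr_ge0.
  - by apply/measurable_EFinP; exact: measurable_funX.
  - by apply: emeasurable_funD => //; exact: measurable_funeM.
  - by move=> w _; rewrite -EFinM -EFinD lee_fin; exact: bound.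
rewrite ge0_integralD//=.
- rewrite integral_cst//= probability_setT mule1 ge0_integralZl_EFin//; last exact: sqr_ge0.
  rewrite integral_indic// setIT.
  apply: (@le_trans _ _ ((e ^+ 2)%:E + (D ^+ 2)%:E * (2 * rho ^+ block t)%:E)%E).
    by rewrite leeD2l// lee_wpmul2l// lee_fin sqr_ge0.
  rewrite -EFinM -EFinD lee_fin -lerBrDl ltW//; apply: smallK => /=.
  by near: t; exact: blockoo.
- by move=> w _; rewrite lee_fin sqr_ge0.
- by move=> w _; rewrite mule_ge0// lee_fin ?sqr_ge0.
- exact: measurable_funeM.
Unshelve. all: by end_near. Qed.

End objectives.

Lemma smallest_capacity_le (R : realType) (X : pmetricType R) (f : X -> X)
    (mu : probability (borel X) R) (obj : objective X) (C : \bar R) :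
  (0 <= C)%E ->
  (forall (A B : finType) (W : dmc R A B) (e : R), (C < capacity W)%E -> 0 < e ->
    exists enc dec, @achieves R X f mu obj A B W enc dec e) ->
  (smallest_capacity f mu obj <= C)%E.
Proof.
move=> C0 achC; apply: ereal_inf_lbound; split => // A B W CW e e0.
exact: achC.
Qed.

Local Open Scope ereal_scope.

Theorem theoremV1 (R : realType) (X : pmetricType R)
    (cptX : compact [set: X]) (f : X -> X) (ctsf : continuous f)
    (mu : probability (borel X) R) :
  smallest_capacity f mu (@objective_E2 R X) <= top_entropy f /\
  smallest_capacity f mu (@objective_E3 R X) <= top_entropy f.
Proof.
split; apply: smallest_capacity_le; try exact: top_entropy_ge0.
  move=> A B W e topW e0.
  have [enc [dec [rho rho01 rel]]] := reliable_tracking mu ctsf e0 topW.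
  by exists enc, dec; exact: reliable_E2 rel.
move=> A B W e topW e0.
(* With s := min 1 (e / 2), s ^ 2 <= s <= e / 2 < e. *)
have e10 : (0 < Num.min 1 (e / 2))%R by rewrite lt_min ltr01 divr_gt0.
have [enc [dec [rho rho01 rel]]] := reliable_tracking mu ctsf e10 topW.
exists enc, dec; apply: (reliable_E3 ctsf rho01 rel cptX).
have le1 : (Num.min 1 (e / 2) <= 1)%R by rewrite ge_min lexx.
have le2 : (Num.min 1 (e / 2) <= e / 2)%R by rewrite ge_min lexx orbT.
rewrite expr2; apply: (@le_lt_trans _ _ (1 * (e / 2))%R); last by lra.
by apply: ler_pM; rewrite // ltW.
Qed.
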